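(* Let $L\in\mathbb{N}_0$ and let $f\colon\mathrm{SO}(3)\to\mathbb{C}$ be an $L$-band-limited function. Then the component functions of the gradient $\nabla f$ with respect to the left-invariant frame $(\partial^L_x,\partial^L_y,\partial^L_z)$, as well as the component functions of $\nabla f$ with respect to the right-invariant frame $(\partial^R_x,\partial^R_y,\partial^R_z)$, are again $L$-band-limited.
   Context: The tangent space of $\mathrm{SO}(3)$ at $R$ is $T_R\mathrm{SO}(3)=R\cdot\mathfrak{so}(3)=\mathfrak{so}(3)\cdot R$ ($\mathfrak{so}(3)$ = real skew-symmetric $3\times 3$ matrices), with Riemannian metric $g_R(T_1,T_2)=\tfrac12\langle T_1,T_2\rangle_F$ (Frobenius inner product). The gradient of a smooth real function $f$ is the vector field with $g_R(\nabla f(R),T)=\mathrm{d}_Tf(R)$ for all $T\in T_R\mathrm{SO}(3)$, where $\mathrm{d}_Tf(R)=\frac{d}{dt}f(\exp(tS)R)|_{t=0}$ for $T=SR$, $S\in\mathfrak{so}(3)$; for complex-valued functions the gradient is extended complex-linearly. Put $$e_x=\begin{pmatrix}0&0&0\\0&0&-1\\0&1&0\end{pmatrix},\quad e_y=\begin{pmatrix}0&0&1\\0&0&0\\-1&0&0\end{pmatrix},\quad e_z=\begin{pmatrix}0&-1&0\\1&0&0\\0&0&0\end{pmatrix}.$$ The left-invariant frame is $\partial^L_x(R)=R e_x$, $\partial^L_y(R)=R e_y$, $\partial^L_z(R)=R e_z$; the right-invariant frame is $\partial^R_x(R)=e_xR$, $\partial^R_y(R)=e_yR$, $\partial^R_z(R)=e_zR$.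 Euler angles: $R(\alpha,\beta,\gamma)=R_z(\alpha)R_y(\beta)R_z(\gamma)$ with $\alpha,\gamma\in\mathbb{R}/2\pi\mathbb{Z}$, $\beta\in[0,\pi]$, where $R_z(t)=\exp(te_z)$, $R_y(t)=\exp(te_y)$. For $l\in\mathbb{N}_0$ and integers $|k|,|k'|\le l$, the Wigner-d function $d_l^{k,k'}\colon[-1,1]\to\mathbb{R}$ is $$d_l^{k,k'}(x)=(-1)^{\nu}\binom{2l-s}{s+a}^{1/2}\binom{s+b}{b}^{-1/2}\left(\frac{1-x}{2}\right)^{a/2}\left(\frac{1+x}{2}\right)^{b/2}P_s^{a,b}(x),$$ with $a=|k-k'|$, $b=|k+k'|$, $s=l-\max\{|k|,|k'|\}$, $\nu=k+k'$ if $k>k'$ and $\nu=0$ otherwise, and $P_s^{a,b}$ the Jacobi polynomial of degree $s$ with parameters $a,b$ (normalized by $P_s^{a,b}(1)=\binom{s+a}{s}$). The Wigner-D function is $D_l^{k,k'}(R(\alpha,\beta,\gamma))=\sqrt{2l+1}\,e^{-ik\alpha}d_l^{k,k'}(\cos\beta)e^{-ik'\gamma}$. A function on $\mathrm{SO}(3)$ is called $L$-band-limited if it lies in $\Pi_L(\mathrm{SO}(3))=\mathrm{span}_{\mathbb{C}}\{D_l^{k,k'} : 0\le l\le L,\ -l\le k,k'\le l\}$. *)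

(* Defs.v *)
From HB Require Import structures.
From mathcomp Require Export all_boot all_order all_algebra.
From mathcomp Require Export complex.
From mathcomp Require Export all_classical all_reals all_analysis.

Set Implicit Arguments.
Unset Strict Implicit.
Unset Printing Implicit Defensive.

Import Order.TTheory GRing.Theory Num.Theory.
Export numFieldNormedType.Exports.

Local Open Scope classical_set_scope.
Local Open Scope ring_scope.
Local Open Scope complex_scope.

(* Functions and vector fields on SO(3) are represented by functions on the
   ambient space of 3x3 matrices; every property below only constrains (and
   only depends on) their values at points of SO(3). *)

Section RotationGroup.
Variable R : realType.

Definition SO3 : set 'M[R]_3 :=
  [set Q | Q^T *m Q = 1%:M /\ \det Q = 1].

Definition so3 : set 'M[R]_3 := [set S | S^T = - S].

Definition tangentSO3 (Q : 'M[R]_3) : set 'M[R]_3 :=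
  [set T | exists2 S, so3 S & T = S *m Q].

Definition metricSO3 (T1 T2 : 'M[R]_3) : R :=
  2^-1 * \sum_(i < 3) \sum_(j < 3) T1 i j * T2 i j.

Definition expmx (A : 'M[R]_3) : 'M[R]_3 :=
  limn (series (fun n : nat => (n`!%:R)^-1 *: A ^+ n)).

Definition mx3 (rows : seq (seq R)) : 'M[R]_3 :=
  \matrix_(i < 3, j < 3) nth 0 (nth [::] rows i) j.

Definition e_x : 'M[R]_3 :=
  mx3 [:: [:: 0; 0; 0]; [:: 0; 0; -1]; [:: 0; 1; 0]].
Definition e_y : 'M[R]_3 :=
  mx3 [:: [:: 0; 0; 1]; [:: 0; 0; 0]; [:: -1; 0; 0]].
Definition e_z : 'M[R]_3 :=
  mx3 [:: [:: 0; -1; 0]; [:: 1; 0; 0]; [:: 0; 0; 0]].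

Definition e_ (j : 'I_3) : 'M[R]_3 := nth 0 [:: e_x; e_y; e_z] j.

Definition leftFrame (j : 'I_3) (Q : 'M[R]_3) : 'M[R]_3 := Q *m e_ j.
Definition rightFrame (j : 'I_3) (Q : 'M[R]_3) : 'M[R]_3 := e_ j *m Q.

Definition Rz (t : R) : 'M[R]_3 := expmx (t *: e_z).
Definition Ry (t : R) : 'M[R]_3 := expmx (t *: e_y).

Definition euler (alpha beta gamma : R) : 'M[R]_3 :=
  Rz alpha *m Ry beta *m Rz gamma.

End RotationGroup.

Section Wigner.
Variable R : realType.

(* The Jacobi polynomial P_s^{a,b} for a, b in nat, by its classical expansion
   in powers of (x - 1)/2 and (x + 1)/2; at x = 1 only m = 0 contributes,
   giving binom(s + a, s). *)
Definition jacobi (s a b : nat) (x : R) : R :=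
  \sum_(m < s.+1) ('C(s + a, s - m) * 'C(s + b, m))%:R
                  * ((x - 1) / 2) ^+ m * ((x + 1) / 2) ^+ (s - m).

(* For 0 <= y, the power y^{a/2} is rendered as (sqrt y)^a (equal to 1 when
   a = 0, also at y = 0). *)
Definition wignerd (l : nat) (k k' : int) (x : R) : R :=
  let a := absz (k - k') in
  let b := absz (k + k') in
  let s := (l - maxn (absz k) (absz k'))%N in
  let nu : int := if k' < k then k + k' else 0 in
  (-1) ^ nu
  * Num.sqrt 'C(2 * l - s, s + a)%:R
  * (Num.sqrt 'C(s + b, b)%:R)^-1
  * Num.sqrt ((1 - x) / 2) ^+ a
  * Num.sqrt ((1 + x) / 2) ^+ b
  * jacobi s a b x.

Definition expNi (t : R) : R[i] := cos t -i* sin t.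

(* Euler angles exist for every rotation but are not unique; the angles are
   picked by choice, and for l, k, k' with |k|, |k'| <= l the value of wignerD
   does not depend on that choice: at beta = 0 or beta = pi, where more than
   alpha and gamma modulo 2 pi is ambiguous, wignerd vanishes unless k = k' or
   k = - k' respectively. *)
Definition eulerAngles (Q : 'M[R]_3) : R * R * R :=
  xget (0, 0, 0)
    [set t : R * R * R | 0 <= t.1.2 <= pi /\ euler t.1.1 t.1.2 t.2 = Q].

Definition wignerD (l : nat) (k k' : int) (Q : 'M[R]_3) : R[i] :=
  let: (alpha, beta, gamma) := eulerAngles Q in
  (Num.sqrt (2 * l + 1)%:R)%:C
  * expNi (k%:~R * alpha) * (wignerd l k k' (cos beta))%:C
  * expNi (k'%:~R * gamma).

(* Membership in the complex span of the D_l^{k,k'} with l <= L; the indices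
   k, k' in {-l, ..., l} are written i - l, j - l with i, j < 2l + 1. *)
Definition bandlimited (L : nat) (f : 'M[R]_3 -> R[i]) : Prop :=
  exists c : nat -> int -> int -> R[i], forall Q, SO3 Q ->
    f Q = \sum_(l < L.+1) \sum_(i < (2 * l).+1) \sum_(j < (2 * l).+1)
            let k := i%:Z - l%:Z in
            let k' := j%:Z - l%:Z in
            c l k k' * wignerD l k k' Q.

End Wigner.

Section Gradient.
Variable R : realType.

Definition mxC (A : 'M[R]_3) : 'M[R[i]]_3 := map_mx (fun x : R => x%:C) A.

(* is_derive asserts both that the derivative at t = 0 exists and its value. *)
Definition is_real_gradient (f : 'M[R]_3 -> R) (G : 'M[R]_3 -> 'M[R]_3) : Prop :=
  forall Q, SO3 Q ->
    tangentSO3 Q (G Q) /\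
    forall S, so3 S ->
      is_derive (0 : R) (1 : R) (fun t : R => f (expmx (t *: S) *m Q))
                (metricSO3 (G Q) (S *m Q)).

Definition is_gradient (f : 'M[R]_3 -> R[i]) (G : 'M[R]_3 -> 'M[R[i]]_3) : Prop :=
  exists GRe GIm : 'M[R]_3 -> 'M[R]_3,
    [/\ is_real_gradient (fun Q => complex.Re (f Q)) GRe,
        is_real_gradient (fun Q => complex.Im (f Q)) GIm &
        forall Q, SO3 Q -> G Q = mxC (GRe Q) + 'i *: mxC (GIm Q)].

Definition is_components (E : 'I_3 -> 'M[R]_3 -> 'M[R]_3)
    (G : 'M[R]_3 -> 'M[R[i]]_3) (c : 'I_3 -> 'M[R]_3 -> R[i]) : Prop :=
  forall Q, SO3 Q -> G Q = \sum_(j < 3) c j Q *: mxC (E j Q).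

End Gradient.

(* Main.v *)
(* On SO(3), band-limitation of degree [L] means being the restriction of a
   complex polynomial of degree at most [L] in the nine matrix entries; both
   frames consist of vector fields [Q |-> A Q B] with linear entries, and
   differentiating along such a field does not raise the degree.

   To compare with the Wigner functions, write
     E_{k,k'} = e^{-ik alpha} sin(beta/2)^{|k-k'|} cos(beta/2)^{|k+k'|} e^{-ik' gamma}.
   The [D_l^{k,k'}] with k, k' fixed are, up to scalars, E_{k,k'} P_s(cos beta)
   with P_s of degree exactly s = l - max(|k|,|k'|), so they span all products of
   E_{k,k'} and a polynomial in cos beta = Q_{33} of bounded degree. Moreover
   E_{k,k'} E_{m,m'} is E_{k+m,k'+m'} times powers of (1 -+ cos beta)/2, and since
   2 max(|k|,|k'|) = |k-k'| + |k+k'|, degrees add up. The E_{k,k'} with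
   max(|k|,|k'|) <= 1, together with cos beta, are linear combinations of [1] and
   the matrix entries and conversely, which identifies the two filtrations. *)

Require Import Defs.
From mathcomp Require Import ring lra zify.

Set Implicit Arguments.
Unset Strict Implicit.
Unset Printing Implicit Defensive.

Import Order.TTheory GRing.Theory Num.Theory.

Local Open Scope classical_set_scope.
Local Open Scope ring_scope.
Local Open Scope complex_scope.

(** * Entrywise computation with 3x3 matrices *)

Notation o0 := (@Ordinal 3 0 isT).
Notation o1 := (@Ordinal 3 1 isT).
Notation o2 := (@Ordinal 3 2 isT).

Lemma forall_ord3 (P : 'I_3 -> Prop) : P o0 -> P o1 -> P o2 -> forall i, P i.
Proof.
move=> P0 P1 P2 [[|[|[|//]]] lt_i3].
- by rewrite (_ : Ordinal _ = o0)//; apply: val_inj.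
- by rewrite (_ : Ordinal _ = o1)//; apply: val_inj.
- by rewrite (_ : Ordinal _ = o2)//; apply: val_inj.
Qed.

Lemma sum_ord3 (V : zmodType) (F : 'I_3 -> V) :
  \sum_(i < 3) F i = F o0 + F o1 + F o2.
Proof.
rewrite !big_ord_recl big_ord0 addr0 addrA.
by congr (F _ + F _ + F _); apply: val_inj.
Qed.

Lemma eq_mx3 (T : Type) (A B : 'M[T]_3) :
  A o0 o0 = B o0 o0 -> A o0 o1 = B o0 o1 -> A o0 o2 = B o0 o2 ->
  A o1 o0 = B o1 o0 -> A o1 o1 = B o1 o1 -> A o1 o2 = B o1 o2 ->
  A o2 o0 = B o2 o0 -> A o2 o1 = B o2 o1 -> A o2 o2 = B o2 o2 -> A = B.
Proof.
by move=> *; apply/matrixP; apply: forall_ord3; apply: forall_ord3.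
Qed.

Lemma det_mx33 (K : comNzRingType) (A : 'M[K]_3) :
  \det A = A o0 o0 * (A o1 o1 * A o2 o2 - A o1 o2 * A o2 o1)
         - A o0 o1 * (A o1 o0 * A o2 o2 - A o1 o2 * A o2 o0)
         + A o0 o2 * (A o1 o0 * A o2 o1 - A o1 o1 * A o2 o0).
Proof.
rewrite (expand_det_row _ o0) sum_ord3 /cofactor.
do 3 rewrite (expand_det_row _ ord0) !big_ord_recl big_ord0 /cofactor !det_mx11.
rewrite !mxE /= !(expr0, expr1, sqrrN, expr1n).
(* The cofactor indices are nested liftings of ordinals; indexing by natural numbers makes equal
   entries syntactically equal. *)
pose a i j := A (inord i) (inord j).
have Aa i j : A i j = a i j by rewrite /a !inord_val.
rewrite !Aa /= /bump /=; ring.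
Qed.

(** * Rodrigues' formula for the exponential of a skew matrix *)

Section Rotations.
Variable R : realType.
Implicit Types (A B S Q : 'M[R]_3) (t th : R).

Definition rodrigues th A t : 'M[R]_3 :=
  1%:M + (sin (t * th) / th) *: A + ((1 - cos (t * th)) / th ^+ 2) *: A ^+ 2.

(** The hypothesis makes odd powers of [A] multiples of [A] and positive even powers multiples of
    [A ^+ 2], so the exponential series splits into a sine and a cosine series. *)
Lemma expmx_rodrigues th A t : th != 0 -> A ^+ 3 = - (th ^+ 2 *: A) ->
  expmx (t *: A) = rodrigues th A t.
Proof.
move=> th0 A3.
have factN0 n : n`!%:R != 0 :> R by rewrite pnatr_eq0 -lt0n fact_gt0.
have Aodd n : A ^+ n.*2.+1 = ((- 1) ^+ n * th ^+ n.*2) *: A.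
  elim: n => [|n IH]; first by rewrite !expr0 mul1r scale1r expr1.
  rewrite doubleS exprSr exprSr IH -!scalerAl -mulrA -[A * (A * A)]/(A ^+ 3) A3.
  by rewrite scalerN scalerA -scaleNr !exprS; congr (_ *: _); ring.
have Aeven n : A ^+ n.*2.+2 = ((- 1) ^+ n * th ^+ n.*2) *: A ^+ 2.
  by rewrite exprS Aodd -scalerAr expr2.
(* [C] repairs the term of index 0, where the cosine series contributes -A^2 / th^2 instead of the
   identity. *)
pose C := 1%:M + (th ^- 2) *: A ^+ 2.
have term n : (n`!%:R)^-1 *: (t *: A) ^+ n =
   (sin_coeff (t * th) n / th) *: A + (- cos_coeff (t * th) n / th ^+ 2) *: A ^+ 2
   + (n == 0%N)%:R *: C.
  rewrite exprZn scalerA.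
  have [-> | [[m ->] | [m ->]]] :
      n = 0%N \/ (exists k, n = k.*2.+1) \/ (exists k, n = k.*2.+2).
    case: n => [|n]; [by left|right].
    rewrite -(odd_double_half n); case: (odd n).
      by right; exists n./2.
    by left; exists n./2.
  - rewrite /sin_coeff /cos_coeff /C /= !expr0 fact0 !mul0r scale0r add0r.
    rewrite !mul1r scale1r invr1 mul1r scale1r mulN1r scaleNr.
    by rewrite addrCA addNr addr0.
  - rewrite Aodd cos_coeff_odd oppr0 mul0r !scale0r !addr0 scalerA.
    rewrite /sin_coeff /= odd_double /= doubleK; congr (_ *: _).
    move: (factN0 m.*2.+1) => f0; rewrite exprMn [th ^+ _.+1]exprS.
    set F := (_ `!)%:R in f0 *. by field; rewrite th0 f0.
  - rewrite Aeven -doubleS sin_coeff_even mul0r !scale0r add0r addr0 scalerA.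
    rewrite /cos_coeff /= odd_double /= doubleK; congr (_ *: _).
    move: (factN0 m.*2.+2) => f0; rewrite exprMn -exprnP !doubleS.
    rewrite [th ^+ m.*2.+2]exprS [th ^+ m.*2.+1]exprS [(-1) ^+ m.+1]exprS.
    set F := (_ `!)%:R in f0 *. by field; rewrite th0 f0.
rewrite /expmx; apply/cvg_lim => //=.
rewrite (_ : series _ = fun N =>
   (series (sin_coeff (t * th)) N / th) *: A +
   (- series (cos_coeff (t * th)) N / th ^+ 2) *: A ^+ 2 +
   (0 < N)%N%:R *: C); last first.
  apply/funext; elim=> [|N IH].
    by rewrite /series /= !big_geq// !mul0r oppr0 mul0r !scale0r !addr0.
  rewrite !seriesSr IH term.
  rewrite !(mulrDl, opprD, scalerDl, mulNr, scaleNr).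
  have -> : ((0 < N.+1)%N%:R : R) = (0 < N)%N%:R + (N == 0%N)%:R.
    by case: N {IH} => //=; rewrite (addr0, add0r).
  rewrite scalerDl.
  by rewrite addrACA; congr (_ + _); rewrite addrACA.
rewrite (_ : rodrigues _ _ _ =  (sin (t * th) / th) *: A +
   (- cos (t * th) / th ^+ 2) *: A ^+ 2 + 1 *: C); last first.
  rewrite /rodrigues /C scale1r.
  have -> : (1 - cos (t * th)) / th ^+ 2 = - cos (t * th) / th ^+ 2 + th ^- 2.
    by ring.
  by rewrite scalerDl [1%:M + _]addrC addrACA.
have cvS : series (sin_coeff (t * th)) @ \oo --> sin (t * th).
  by rewrite unlock; exact: is_cvg_series_sin_coeff.
have cvC : series (cos_coeff (t * th)) @ \oo --> cos (t * th).
  by rewrite unlock; exact: is_cvg_series_cos_coeff.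
apply: cvgD; first apply: cvgD.
- by apply: cvgZr_tmp; apply: cvgM => //; exact: cvg_cst.
- by apply: cvgZr_tmp; apply: cvgM; [exact: cvgN|exact: cvg_cst].
- apply: cvgZr_tmp; apply: cvg_near_cst.
  by exists 1%N => // n /= ->.
Qed.

(** The matrix of the cross product with the vector (x, y, z). *)
Definition skew (x y z : R) : 'M[R]_3 :=
  mx3 [:: [:: 0; - z; y]; [:: z; 0; - x]; [:: - y; x; 0]].

Lemma so3_skew S : so3 S -> S = skew (S o2 o1) (S o0 o2) (S o1 o0).
Proof.
move=> /matrixP skS; have skE i j : S j i = - S i j by move: (skS i j); rewrite !mxE.
by apply: eq_mx3; rewrite !mxE /=; rewrite 1?skE //; 
  have := (skE o0 o0); have := skE o1 o1; have := skE o2 o2; lra.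
Qed.

Lemma skew_so3 x y z : so3 (skew x y z).
Proof. by apply: eq_mx3; rewrite !mxE /= ?opprK ?oppr0. Qed.

Lemma skew_cube x y z :
  skew x y z ^+ 3 = - ((x ^+ 2 + y ^+ 2 + z ^+ 2) *: skew x y z).
Proof.
rewrite !exprS expr0 -!mulmxE mulmx1.
by apply: eq_mx3; rewrite !(mxE, sum_ord3) /=; ring.
Qed.

(** For the Rodrigues coefficients the relation between [a] and [b] is sin^2 + cos^2 = 1. *)
Lemma SO3_rodrigues_skew (a b x y z : R) :
  a ^+ 2 = 2 * b - b ^+ 2 * (x ^+ 2 + y ^+ 2 + z ^+ 2) ->
  SO3 (1%:M + a *: skew x y z + b *: skew x y z ^+ 2).
Proof.
move=> ab; split.
  by rewrite expr2 -mulmxE; apply: eq_mx3; rewrite !(mxE, sum_ord3) /=; ring: ab.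
by rewrite det_mx33 expr2 -mulmxE !(mxE, sum_ord3) /=; ring: ab.
Qed.

Lemma SO3_1 : SO3 (1%:M : 'M[R]_3).
Proof. by split; rewrite ?trmx1 ?mulmx1 ?det1. Qed.

(* The angular speed [th] is replaced by [1] when [S = 0], so that dividing by
   it stays meaningful. *)
Lemma expmx_so3 S : so3 S -> exists th, [/\ th != 0,
  forall t, expmx (t *: S) = rodrigues th S t & forall t, SO3 (rodrigues th S t)].
Proof.
move=> /so3_skew; move: (S o2 o1) (S o0 o2) (S o1 o0) => x y z ->.
have cube := skew_cube x y z.
have [n0|n_neq0] := eqVneq (x ^+ 2 + y ^+ 2 + z ^+ 2) 0.
  have S0 : skew x y z = 0.
    move: n0 => /eqP; rewrite !paddr_eq0 ?addr_ge0 ?sqr_ge0 // !sqrf_eq0.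
    case/andP => /andP[/eqP-> /eqP->] /eqP->.
    by apply: eq_mx3; rewrite !mxE /= ?oppr0.
  exists 1; rewrite S0; split; first exact: oner_neq0.
    by move=> t; apply: expmx_rodrigues; rewrite ?oner_neq0// expr0n scaler0 oppr0.
  by move=> t; rewrite /rodrigues expr0n !scaler0 !addr0; exact: SO3_1.
have n_ge0 : 0 <= x ^+ 2 + y ^+ 2 + z ^+ 2 by rewrite !addr_ge0 ?sqr_ge0.
exists (Num.sqrt (x ^+ 2 + y ^+ 2 + z ^+ 2)).
have th0 : Num.sqrt (x ^+ 2 + y ^+ 2 + z ^+ 2) != 0.
  by rewrite sqrtr_eq0 -ltNge lt_neqAle eq_sym n_neq0.
split=> // t; first by apply: expmx_rodrigues; rewrite // sqr_sqrtr.
apply: SO3_rodrigues_skew; move: (sqr_sqrtr n_ge0) th0.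
set th := Num.sqrt _ => <- th0.
have := sin2cos2 (t * th); move: (cos _) (sin _) => c s cs.
by field: cs.
Qed.

Lemma SO3_expmx S t : so3 S -> SO3 (expmx (t *: S)).
Proof. by move=> /expmx_so3[th [_ -> ]]. Qed.

Lemma SO3_mul Q1 Q2 : SO3 Q1 -> SO3 Q2 -> SO3 (Q1 *m Q2).
Proof.
move=> [Q1Q1 d1] [Q2Q2 d2]; split; last by rewrite det_mulmx d1 d2 mulr1.
by rewrite trmx_mul -mulmxA [Q1^T *m _]mulmxA Q1Q1 mul1mx.
Qed.

Lemma SO3_tr Q : SO3 Q -> SO3 Q^T.
Proof.
by move=> [QQ d]; split; rewrite ?det_tr// trmxK; exact: mulmx1C.
Qed.

End Rotations.

(** * Derivatives along exponential curves and existence of Euler angles *)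

Section EulerAngles.
Variable R : realType.
Implicit Types (A B S Q : 'M[R]_3) (t th : R).

(** By Rodrigues' formula the entry is explicit in sine and cosine, and at t = 0 only the sine term
    contributes to the derivative. *)
Lemma is_derive_expmx S Q i j : so3 S ->
  is_derive (0 : R) (1 : R) (fun t => (expmx (t *: S) *m Q) i j) ((S *m Q) i j).
Proof.
move=> /expmx_so3[th [th0 expE _]].
rewrite (_ : (fun t => _) = (fun t => Q i j + (S *m Q) i j / th * sin (t * th) +
    ((S ^+ 2 *m Q) i j / th ^+ 2) * (1 - cos (t * th)))); last first.
  apply/funext => t; rewrite expE /rodrigues !mulmxDl mul1mx -!scalemxAl.
  by rewrite !mxE; field.
have dth : is_derive (0 : R) (1 : R) (fun t : R => t * th) th.
  by apply: is_derive_eq; rewrite /GRing.scale /= mulr0 mulr1 add0r.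
have dsin : is_derive (0 : R) (1 : R) (fun t => sin (t * th)) th.
  have := @is_derive1_comp _ sin (fun t => t * th) 0 _ _ (is_derive_sin _) dth.
  move=> /is_derive_eq; apply.
  by rewrite mul0r cos0 mul1r.
have dcos : is_derive (0 : R) (1 : R) (fun t => cos (t * th)) 0.
  have := @is_derive1_comp _ cos (fun t => t * th) 0 _ _ (is_derive_cos _) dth.
  move=> /is_derive_eq; apply.
  by rewrite mul0r sin0 oppr0 mul0r.
apply: is_derive_eq.
by rewrite oppr0 mulr0 scaler0 addr0 add0r mul1r; exact: divfK.
Qed.

Lemma RzE t : Rz t =
  mx3 [:: [:: cos t; - sin t; 0]; [:: sin t; cos t; 0]; [:: 0; 0; 1]].
Proof.
have ez : e_z R = skew 0 0 1 by apply: eq_mx3; rewrite !mxE /= ?oppr0.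
rewrite /Rz (@expmx_rodrigues _ 1) ?oner_neq0 //; last first.
  by rewrite ez skew_cube !expr0n /= !expr1n !add0r.
rewrite /rodrigues mulr1 expr1n !divr1 ez expr2 -mulmxE.
by apply: eq_mx3; rewrite !(mxE, sum_ord3) /=; ring.
Qed.

Lemma RyE t : Ry t =
  mx3 [:: [:: cos t; 0; sin t]; [:: 0; 1; 0]; [:: - sin t; 0; cos t]].
Proof.
have ey : e_y R = skew 0 1 0 by apply: eq_mx3; rewrite !mxE /= ?oppr0.
rewrite /Ry (@expmx_rodrigues _ 1) ?oner_neq0 //; last first.
  by rewrite ey skew_cube !expr0n /= !expr1n !add0r addr0.
rewrite /rodrigues mulr1 expr1n !divr1 ey expr2 -mulmxE.
by apply: eq_mx3; rewrite !(mxE, sum_ord3) /=; ring.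
Qed.

Lemma eulerE a b c : euler a b c = @mx3 R
  [:: [:: cos a * cos b * cos c - sin a * sin c;
          - cos a * cos b * sin c - sin a * cos c; cos a * sin b];
      [:: sin a * cos b * cos c + cos a * sin c;
          - sin a * cos b * sin c + cos a * cos c; sin a * sin b];
      [:: - sin b * cos c; sin b * sin c; cos b]].
Proof.
rewrite /euler !RzE RyE.
by apply: eq_mx3; rewrite !(mxE, sum_ord3) /=; ring.
Qed.

Lemma Rz_SO3 t : SO3 (Rz t).
Proof.
by apply: SO3_expmx; have -> : e_z R = skew 0 0 1;
  [by apply: eq_mx3; rewrite !mxE /= ?oppr0|exact: skew_so3].
Qed.

Lemma Ry_SO3 t : SO3 (Ry t).
Proof.
by apply: SO3_expmx; have -> : e_y R = skew 0 1 0;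
  [by apply: eq_mx3; rewrite !mxE /= ?oppr0|exact: skew_so3].
Qed.

(** The arccosine of x gives the angle up to sign, and the sign of y decides. *)
Lemma circle_angle x y : x ^+ 2 + y ^+ 2 = 1 -> exists t, x = cos t /\ y = sin t.
Proof.
move=> xy1.
have x1 : -1 <= x <= 1.
  rewrite -ler_norml -(@ler_pXn2r _ 2) ?nnegrE // expr1n real_normK ?num_real//.
  by rewrite -xy1 lerDl sqr_ge0.
have xK : cos (acos x) = x by rewrite acosK.
have sE : sin (acos x) = `|y|.
  by rewrite sin_acos// -xy1 addrAC subrr add0r sqrtr_sqr.
have [y0|y0] := leP 0 y.
  by exists (acos x); rewrite xK sE ger0_norm.
by exists (- acos x); rewrite cosN sinN xK sE ltr0_norm// opprK.
Qed.

Lemma polar_angle x y : exists t,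
  x = Num.sqrt (x ^+ 2 + y ^+ 2) * cos t /\ y = Num.sqrt (x ^+ 2 + y ^+ 2) * sin t.
Proof.
have n_ge0 : 0 <= x ^+ 2 + y ^+ 2 by rewrite addr_ge0 ?sqr_ge0.
have [n0|n_neq0] := eqVneq (x ^+ 2 + y ^+ 2) 0.
  exists 0; rewrite n0 sqrtr0 !mul0r.
  by move: n0 => /eqP; rewrite paddr_eq0 ?sqr_ge0 // !sqrf_eq0 => /andP[/eqP-> /eqP->].
move: (sqr_sqrtr n_ge0).
have : Num.sqrt (x ^+ 2 + y ^+ 2) != 0.
  by rewrite sqrtr_eq0 -ltNge lt_neqAle eq_sym n_neq0.
set r := Num.sqrt _ => r0 rE.
have [|t [xE yE]] := @circle_angle (x / r) (y / r).
  by rewrite !expr_div_n -mulrDl -rE divff// expf_neq0.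
by exists t; rewrite -xE -yE ![r * _]mulrC !divfK.
Qed.

(** Unit norm of the last row and of the last column clears their other entries, which leaves a
    rotation of the plane. *)
Lemma SO3_fix_ez Q : SO3 Q -> Q o2 o2 = 1 -> exists t, Q = Rz t.
Proof.
move=> SQ Q22; have [QtQ dQ] := SQ; have [] := SO3_tr SQ; rewrite trmxK => QQt _.
have entry (A : 'M[R]_3) i j : A = 1%:M -> A i j = (i == j)%:R.
  by move=> ->; rewrite mxE.
have := entry _ o2 o2 QtQ; have := entry _ o2 o2 QQt; have := entry _ o0 o0 QtQ.
have := entry _ o1 o1 QtQ; move: dQ.
rewrite det_mx33 !(mxE, sum_ord3) /= Q22.
move=> dQ eqb eqa eqr eqc.
have z2 (x y : R) : x * x + y * y + 1 * 1 = 1 -> x = 0 /\ y = 0.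
  move=> xy; have : x ^+ 2 + y ^+ 2 = 0 by rewrite !expr2; lra.
  by move=> /eqP; rewrite paddr_eq0 ?sqr_ge0 // !sqrf_eq0 => /andP[/eqP-> /eqP->].
have [Q02 Q12] := z2 _ _ eqc; have [Q20 Q21] := z2 _ _ eqr.
rewrite Q20 Q21 in dQ eqa eqb; rewrite Q02 Q12 in dQ.
(* This is the sum of squares of the upper left block minus twice its determinant, that is 2 - 2. *)
have : (Q o0 o0 - Q o1 o1) ^+ 2 + (Q o0 o1 + Q o1 o0) ^+ 2 = 0.
  by rewrite !expr2; lra.
move=> /eqP; rewrite paddr_eq0 ?sqr_ge0 // !sqrf_eq0 => /andP[/eqP diag /eqP off].
have [|t [cosE sinE]] := @circle_angle (Q o0 o0) (Q o1 o0); first by rewrite !expr2; lra.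
by exists t; rewrite RzE; apply: eq_mx3; rewrite !mxE /= -?cosE -?sinE; lra.
Qed.

(** The third column yields alpha as a polar angle and beta as an arccosine; undoing both rotations
    leaves one that fixes the z-axis, and its angle is gamma. *)
Lemma euler_exists Q : SO3 Q ->
  exists t : R * R * R, 0 <= t.1.2 <= pi /\ euler t.1.1 t.1.2 t.2 = Q.
Proof.
move=> SQ; have [a [Q02 Q12]] := polar_angle (Q o0 o2) (Q o1 o2).
have := congr1 (fun A : 'M[R]_3 => A o2 o2) SQ.1.
rewrite !(mxE, sum_ord3) /= -!expr2 => col.
set r := Num.sqrt _ in Q02 Q12.
have rE : r ^+ 2 = 1 - Q o2 o2 ^+ 2.
  by rewrite sqr_sqrtr ?addr_ge0 ?sqr_ge0//; move: col; rewrite [X in _ = X -> _]/=; lra.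
have Q22 : -1 <= Q o2 o2 <= 1.
  rewrite -ler_norml -(@ler_pXn2r _ 2) ?nnegrE // expr1n real_normK ?num_real//.
  by rewrite -subr_ge0 -rE sqr_ge0.
pose b := acos (Q o2 o2).
have cb : cos b = Q o2 o2 by rewrite acosK.
have sb : sin b = r by rewrite sin_acos// -rE sqrtr_sqr ger0_norm// sqrtr_ge0.
have SM : SO3 ((Ry b)^T *m ((Rz a)^T *m Q)).
  by do 2?apply: SO3_mul => //; apply: SO3_tr; [exact: Ry_SO3|exact: Rz_SO3].
have [|c QE] := SO3_fix_ez SM.
  rewrite RzE RyE !(mxE, sum_ord3) /= Q02 Q12 -cb -sb.
  by have ha := sin2cos2 a; have hb := sin2cos2 b; ring: ha hb.
exists (a, b, c); split=> /=; first by rewrite acos_ge0 ?acos_lepi.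
have inv A : SO3 A -> A *m A^T = 1%:M by move=> [/mulmx1C].
rewrite /euler -QE !mulmxA -[_ *m Ry b *m _]mulmxA (inv _ (Ry_SO3 _)) mulmx1.
by rewrite (inv _ (Rz_SO3 _)) mul1mx.
Qed.

End EulerAngles.

(** * Polynomials in the matrix entries and their differentials *)

Section Polynomials.
Variable R : realType.
Implicit Types (S T U Q : 'M[R]_3) (f g : 'M[R]_3 -> R[i]) (m n : nat).

(* Restrictions to SO(3) of complex polynomials of degree at most [n] in the
   matrix entries. *)
Inductive poly_le : nat -> ('M[R]_3 -> R[i]) -> Prop :=
| poly_le_cst n c : poly_le n (fun=> c)
| poly_le_entry i j : poly_le 1 (fun Q => (Q i j)%:C)
| poly_le_add n f g :
    poly_le n f -> poly_le n g -> poly_le n (fun Q => f Q + g Q)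
| poly_le_mul m n f g :
    poly_le m f -> poly_le n g -> poly_le (m + n) (fun Q => f Q * g Q)
| poly_le_eq n f g :
    poly_le n f -> (forall Q, SO3 Q -> f Q = g Q) -> poly_le n g.

Lemma poly_le_leq m n f : (m <= n)%N -> poly_le m f -> poly_le n f.
Proof.
move=> /subnK <- mf.
(* The constant 1, counted with nominal degree n - m, fills the gap. *)
apply: (@poly_le_eq _ (fun Q => 1 * f Q)) => [|Q _]; last by rewrite mul1r.
by apply: poly_le_mul => //; exact: poly_le_cst.
Qed.

Lemma poly_le_scale n c f : poly_le n f -> poly_le n (fun Q => c * f Q).
Proof. by apply: (@poly_le_mul 0); exact: poly_le_cst. Qed.

Lemma poly_le_sum n I (r : seq I) (F : I -> 'M[R]_3 -> R[i]) :
  (forall i, poly_le n (F i)) -> poly_le n (fun Q => \sum_(i <- r) F i Q).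
Proof.
move=> nF; elim: r => [|i r IH].
  by apply: (poly_le_eq (poly_le_cst n 0)) => Q _; rewrite big_nil.
apply: (poly_le_eq (poly_le_add (nF i) IH)) => Q _.
by rewrite big_cons.
Qed.

Definition has_dir_derive f Q S (v : R[i]) :=
  is_derive (0 : R) (1 : R) (fun t => complex.Re (f (expmx (t *: S) *m Q)))
    (complex.Re v) /\
  is_derive (0 : R) (1 : R) (fun t => complex.Im (f (expmx (t *: S) *m Q)))
    (complex.Im v).

Lemma expmx0 S : so3 S -> expmx (0 *: S) = 1%:M.
Proof.
move=> /expmx_so3[th [_ -> _]].
by rewrite /rodrigues !mul0r sin0 cos0 subrr !mul0r !scale0r !addr0.
Qed.

Lemma ReD (x y : R[i]) : complex.Re (x + y) = complex.Re x + complex.Re y.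
Proof. by case: x; case: y. Qed.
Lemma ImD (x y : R[i]) : complex.Im (x + y) = complex.Im x + complex.Im y.
Proof. by case: x; case: y. Qed.
Lemma ReM (x y : R[i]) : complex.Re (x * y) =
  complex.Re x * complex.Re y - complex.Im x * complex.Im y.
Proof. by case: x; case: y. Qed.
Lemma ImM (x y : R[i]) : complex.Im (x * y) =
  complex.Re x * complex.Im y + complex.Im x * complex.Re y.
Proof. by case: x; case: y. Qed.

Lemma has_dir_deriveM f g Q S v w : so3 S ->
  has_dir_derive f Q S v -> has_dir_derive g Q S w ->
  has_dir_derive (fun Q => f Q * g Q) Q S (f Q * w + v * g Q).
Proof.
move=> sS [fRe fIm] [gRe gIm]; split.
- rewrite (_ : (fun t => _) = (fun t =>
    complex.Re (f (expmx (t *: S) *m Q)) * complex.Re (g (expmx (t *: S) *m Q)) -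
    complex.Im (f (expmx (t *: S) *m Q)) * complex.Im (g (expmx (t *: S) *m Q)))).
    apply: is_derive_eq.
    by rewrite /= expmx0// mul1mx ReD !ReM /GRing.scale /=; ring.
  by apply/funext => t; rewrite ReM.
- rewrite (_ : (fun t => _) = (fun t =>
    complex.Re (f (expmx (t *: S) *m Q)) * complex.Im (g (expmx (t *: S) *m Q)) +
    complex.Im (f (expmx (t *: S) *m Q)) * complex.Re (g (expmx (t *: S) *m Q)))).
    apply: is_derive_eq.
    by rewrite /= expmx0// mul1mx ImD !ImM /GRing.scale /=; ring.
  by apply/funext => t; rewrite ImM.
Qed.

(** [d Q T] is the differential at [Q] in direction [T] of a polynomial expression for [f], built
    along the construction of [f]. The field Q -> A Q B has linear entries, so the Leibniz rule
    preserves the degree; taking one of [A], [B] to be the identity will cover both frames. *)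
Lemma poly_le_derive n f : poly_le n f ->
  exists d : 'M[R]_3 -> 'M[R]_3 -> R[i], [/\
    forall Q a T U, d Q (a *: T + U) = a%:C * d Q T + d Q U,
    forall Q S, SO3 Q -> so3 S -> has_dir_derive f Q S (d Q (S *m Q)) &
    forall A B : 'M[R]_3, poly_le n (fun Q => d Q (A *m Q *m B))].
Proof.
elim=> {n f} [n c|i j|n f g _ [d [dlin dder dpol]] _ [e [elin eder epol]]
  |m n f g mf [d [dlin dder dpol]] ng [e [elin eder epol]]
  |n f g _ [d [dlin dder dpol]] fg].
- exists (fun _ _ => 0); split.
  + by move=> *; rewrite mulr0 addr0.
  + by move=> Q S _ _; split; exact: is_derive_cst.
  + by move=> *; exact: poly_le_cst.
- exists (fun Q T => (T i j)%:C); split.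
  + by move=> Q a T U; rewrite !mxE rmorphD rmorphM.
  + move=> Q S _ sS; split; [exact: is_derive_expmx|exact: is_derive_cst].
  + move=> A B.
    apply: (@poly_le_eq _ (fun Q => \sum_k \sum_l ((A i l * B k j)%:C * (Q l k)%:C))).
      apply: poly_le_sum => k; apply: poly_le_sum => l.
      by apply: poly_le_scale; exact: poly_le_entry.
    move=> Q _; rewrite mxE rmorph_sum; apply: eq_bigr => k _.
    rewrite mxE mulr_suml rmorph_sum; apply: eq_bigr => l _.
    by rewrite -rmorphM; congr (_%:C); ring.
- exists (fun Q T => d Q T + e Q T); split.
  + by move=> *; rewrite dlin elin; ring.
  + move=> Q S SQ sS; have [fRe fIm] := dder _ _ SQ sS.
    have [gRe gIm] := eder _ _ SQ sS; split.
      rewrite ReD (_ : (fun t => _) = (fun t => complex.Re (f (expmx (t *: S) *m Q)) +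
        complex.Re (g (expmx (t *: S) *m Q)))); first exact: is_deriveD.
      by apply/funext => t; rewrite ReD.
    rewrite ImD (_ : (fun t => _) = (fun t => complex.Im (f (expmx (t *: S) *m Q)) +
        complex.Im (g (expmx (t *: S) *m Q)))); first exact: is_deriveD.
      by apply/funext => t; rewrite ImD.
  + by move=> A B; exact: poly_le_add.
- exists (fun Q T => f Q * e Q T + d Q T * g Q); split.
  + by move=> *; rewrite dlin elin; ring.
  + by move=> Q S SQ sS; apply: has_dir_deriveM; [|exact: dder|exact: eder].
  + by move=> A B; apply: poly_le_add; apply: poly_le_mul.
(* The curve exp(tS) Q stays in SO(3), where [f] and [g] agree, so one differential serves both. *)
- exists d; split=> // Q S SQ sS; have [fRe fIm] := dder _ _ SQ sS.
  have expg t : g (expmx (t *: S) *m Q) = f (expmx (t *: S) *m Q).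
    by rewrite fg//; apply: SO3_mul => //; exact: SO3_expmx.
  split.
    rewrite (_ : (fun t => _) = (fun t => complex.Re (f (expmx (t *: S) *m Q))))//.
    by apply/funext => t; rewrite expg.
  rewrite (_ : (fun t => _) = (fun t => complex.Im (f (expmx (t *: S) *m Q))))//.
  by apply/funext => t; rewrite expg.
Qed.

End Polynomials.

(** * The weight functions, their products and their low-degree cases *)

Section Weights.
Variable R : realType.
Implicit Types (Q : 'M[R]_3) (f g : 'M[R]_3 -> R[i]) (L l m n : nat) (k : int).

(* The [D_l^{k,k'}] without normalization and without its Jacobi factor; in
   contrast to [d_l^{k,k'}] it is multiplicative in [(k, k')] up to powers of
   [(1 - cos beta) / 2] and [(1 + cos beta) / 2]. *)
Definition weight k k' Q : R[i] :=
  let: (alpha, beta, gamma) := eulerAngles Q in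
  expNi (k%:~R * alpha)
  * (Num.sqrt ((1 - cos beta) / 2) ^+ absz (k - k')
     * Num.sqrt ((1 + cos beta) / 2) ^+ absz (k + k'))%:C
  * expNi (k'%:~R * gamma).

(** Every rotation has Euler angles, so the default value of the choice never occurs on SO(3). *)
Lemma eulerAnglesP Q : SO3 Q -> let: (alpha, beta, gamma) := eulerAngles Q in
  0 <= beta <= pi /\ euler alpha beta gamma = Q.
Proof.
move=> /euler_exists euQ; rewrite /eulerAngles; case: xgetP => [[[a b] c]|no].
  by move=> _ /=.
by have [t /no] := euQ.
Qed.

(** Here x = sin(beta/2) and y = cos(beta/2); the three algebraic relations stand in for half-angle
    formulas. *)
Lemma weight_angles Q : SO3 Q -> exists a b c x y : R, [/\ Q = euler a b c,
  x ^+ 2 = (1 - cos b) / 2, y ^+ 2 = (1 + cos b) / 2, x * y = sin b / 2 &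
  forall k k', weight k k' Q =
    expNi (k%:~R * a) * (x ^+ absz (k - k') * y ^+ absz (k + k'))%:C
    * expNi (k'%:~R * c)].
Proof.
move=> /eulerAnglesP; rewrite /weight; case: (eulerAngles Q) => [[a b] c].
move=> [b_ge0 <-]; exists a, b, c, (Num.sqrt ((1 - cos b) / 2)),
  (Num.sqrt ((1 + cos b) / 2)).
have c1 : 0 <= (1 - cos b) / 2 by rewrite divr_ge0// subr_ge0 cos_le1.
have c2 : 0 <= (1 + cos b) / 2 by rewrite divr_ge0// -lerBlDl sub0r cos_geN1.
split=> //; rewrite ?sqr_sqrtr// -sqrtrM//.
have -> : (1 - cos b) / 2 * ((1 + cos b) / 2) = (sin b / 2) ^+ 2.
  by rewrite expr_div_n sin2cos2; field.
by rewrite sqrtr_sqr ger0_norm// divr_ge0// sin_ge0_pi// in_itv.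
Qed.

Lemma expNiD (s t : R) : expNi (s + t) = expNi s * expNi t.
Proof.
apply/eqP; rewrite eq_complex /= cosD sinD; apply/andP.
by split; apply/eqP; ring.
Qed.

(** The excess is 0 for equal signs and twice the smaller modulus for opposite ones. Its evenness
    turns surplus half-angle factors into polynomials in cos beta. *)
Lemma absz_add_defect (x y : int) :
  exists i, (absz x + absz y = absz (x + y)%R + i.*2)%N.
Proof.
have [xy|xy] := boolP ((0 <= x) == (0 <= y)).
  by exists 0%N; lia.
by exists (minn (absz x) (absz y)); lia.
Qed.

(** The exponentials multiply exactly; the surplus factors sin(beta/2)^(2i) and cos(beta/2)^(2j) are
    powers of (1 - cos beta)/2 and (1 + cos beta)/2, with cos beta the last diagonal entry. *)
Lemma weightM (k k' m m' : int) i j :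
  (absz (k - k')%R + absz (m - m')%R = absz (k + m - (k' + m'))%R + i.*2)%N ->
  (absz (k + k')%R + absz (m + m')%R = absz (k + m + (k' + m'))%R + j.*2)%N ->
  forall Q, SO3 Q -> weight k k' Q * weight m m' Q = weight (k + m) (k' + m') Q
    * (2^-1 * (1 - (Q o2 o2)%:C)) ^+ i * (2^-1 * (1 + (Q o2 o2)%:C)) ^+ j.
Proof.
move=> Ei Ej Q /weight_angles[a [b [c [x [y [-> xx yy xy W]]]]]].
have half : (2^-1 : R[i]) = (2^-1)%:C by rewrite fmorphV rmorph_nat.
have -> : 2^-1 * (1 - (euler a b c o2 o2)%:C) = (x ^+ 2)%:C.
  by rewrite eulerE mxE /= half -(rmorph1 (real_complex R)) -rmorphB -rmorphM xx mulrC.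
have -> : 2^-1 * (1 + (euler a b c o2 o2)%:C) = (y ^+ 2)%:C.
  by rewrite eulerE mxE /= half -(rmorph1 (real_complex R)) -rmorphD -rmorphM yy mulrC.
rewrite !W !intrD !mulrDl !expNiD.
transitivity (expNi (k%:~R * a) * expNi (m%:~R * a) * expNi (k'%:~R * c) *
    expNi (m'%:~R * c) * (x ^+ (absz (k - k')%R + absz (m - m')%R) *
    y ^+ (absz (k + k')%R + absz (m + m')%R))%:C).
  by rewrite !exprD !rmorphM; ring.
rewrite Ei Ej !exprD -!mul2n !exprM !rmorphM !rmorphXn /=; ring.
Qed.

Let I : R[i] := Complex 0 1.

(** Apart from the constant case, these weights are quadratic in sin(beta/2) and cos(beta/2), hence
    linear in 1, cos beta and sin beta; comparison with the Euler matrix gives the coefficients. *)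
Lemma weight_generators Q : SO3 Q -> let h : R[i] := (2^-1)%:C in
  let q i j := (Q i j)%:C in
  [/\ weight 0 0 Q = 1,
   [/\ weight 1 0 Q = h * q o0 o2 + (- I * h) * q o1 o2 &
       weight (-1) 0 Q = h * q o0 o2 + (I * h) * q o1 o2],
   [/\ weight 0 1 Q = - h * q o2 o0 + (- I * h) * q o2 o1 &
       weight 0 (-1) Q = - h * q o2 o0 + (I * h) * q o2 o1],
   [/\ weight 1 1 Q = h * q o0 o0 + h * q o1 o1
         + (- I * h) * q o1 o0 + (I * h) * q o0 o1 &
       weight (-1) (-1) Q = h * q o0 o0 + h * q o1 o1
         + (I * h) * q o1 o0 + (- I * h) * q o0 o1] &
   [/\ weight 1 (-1) Q = h * q o1 o1 + - h * q o0 o0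
         + (I * h) * q o0 o1 + (I * h) * q o1 o0 &
       weight (-1) 1 Q = h * q o1 o1 + - h * q o0 o0
         + (- I * h) * q o0 o1 + (- I * h) * q o1 o0]].
Proof.
move=> /weight_angles[a [b [c [x [y [-> xx yy xy W]]]]]] /=; rewrite !W eulerE /= !mxE /=.
have yx : y ^+ 1 * x ^+ 1 = sin b / 2 by rewrite mulrC.
do !split; apply/eqP; rewrite eq_complex /=; apply/andP; split; apply/eqP;
  rewrite ?(expr0, expr1, mul1r, mulr1, xx, yy, xy, mulN1r, mul0r, cos0, sin0, cosN, sinN);
  by field.
Qed.

End Weights.

(** * Wigner functions as weights times polynomials in cos beta *)

Section WignerPolynomials.
Variable R : realType.
Implicit Types (Q : 'M[R]_3) (f g : 'M[R]_3 -> R[i]) (L l n : nat) (k : int).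

Lemma poly_le_weight_generator p q : (absz p <= 1)%N -> (absz q <= 1)%N ->
  poly_le 1 (@weight R p q).
Proof.
have val1 (z : int) : (absz z <= 1)%N -> [\/ z = 0, z = 1 | z = -1].
  case: z => [[|[|//]]|[|//]] _; [exact: Or31|exact: Or32|exact: Or33].
have Pe i j c : poly_le 1 (fun Q : 'M[R]_3 => c * (Q i j)%:C).
  by apply: poly_le_scale; exact: poly_le_entry.
(* The polynomial is left open and filled in by unification with the matching one of the nine
   identities. *)
move=> /val1[]-> /val1[]->; (apply: poly_le_eq;
  last by move=> Q /weight_generators /= [w00 [w10 wN0] [w01 w0N] [w11 wNN] [w1N wN1]];
    first [exact: esym w00 | exact: esym w10 | exact: esym wN0 | exact: esym w01
      | exact: esym w0N | exact: esym w11 | exact: esym wNN | exact: esym w1N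
      | exact: esym wN1]);
  do 4?[apply: poly_le_add]; by [exact: Pe | exact: poly_le_cst].
Qed.

(** Generators are split off one at a time so that neither k - k' nor k + k' suffers cancellation;
    the product formula then holds with no surplus factor. *)
Lemma poly_le_weight n (k k' : int) : (maxn (absz k) (absz k') <= n)%N ->
  poly_le n (@weight R k k').
Proof.
elim: n k k' => [|n IH] k k' kn.
  have [-> ->] : k = 0 /\ k' = 0 by lia.
  apply: poly_le_eq (poly_le_cst 0 1) _ => Q SQ.
  by have [->] := weight_generators SQ.
have toward (z : int) : exists p : int,
    z = 0 /\ p = 0 \/ 0 < z /\ p = 1 \/ z < 0 /\ p = - 1.
  by have [z0|z0|->] := ltrgtP z 0; [exists (-1)|exists 1|exists 0]; lia.
have [p kp] := toward k; have [q kq] := toward k'.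
have [p' [q' [p1 q1 kn' Ei Ej]]] : exists p' q' : int, [/\ (absz p' <= 1)%N,
    (absz q' <= 1)%N, (maxn (absz (k - p')%R) (absz (k' - q')%R) <= n)%N,
    (absz (p' - q')%R + absz ((k - p') - (k' - q'))%R = absz (k - k')%R)%N &
    (absz (p' + q')%R + absz ((k - p') + (k' - q'))%R = absz (k + k')%R)%N].
  (* Only the index of larger modulus moves one unit toward 0; in a tie both move, since otherwise
     the maximum would not drop. *)
  have [kk|kk|kk] := ltngtP (absz k) (absz k').
  - by exists 0, q; split; lia.
  - by exists p, 0; split; lia.
  - by exists p, q; split; lia.
have Pn := poly_le_mul (poly_le_weight_generator p1 q1) (IH _ _ kn').
apply: poly_le_eq Pn _ => Q SQ.
have E (z p0 : int) : p0 + (z - p0) = z by ring.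
by rewrite (@weightM _ _ _ _ _ 0 0)// !E ?addn0 // !expr0 !mulr1.
Qed.

Lemma poly_le_horner n (P : {poly R[i]}) : (size P <= n.+1)%N ->
  poly_le n (fun Q => P.[(Q o2 o2)%:C]).
Proof.
move=> Pn; have Ppow i : poly_le i (fun Q => (Q o2 o2)%:C ^+ i).
  elim: i => [|i IH].
    by apply: poly_le_eq (poly_le_cst 0 1) _ => Q _; rewrite expr0.
  apply: poly_le_eq (poly_le_mul (@poly_le_entry R o2 o2) IH) _ => Q _.
  by rewrite exprS.
apply: (@poly_le_eq _ _ (fun Q => \sum_(i < n.+1) P`_i * (Q o2 o2)%:C ^+ i)).
  apply: poly_le_sum => i; apply: poly_le_scale.
  by apply: poly_le_leq (Ppow i); rewrite -ltnS.
by move=> Q _; rewrite (horner_coef_wide _ Pn).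
Qed.

(** The halves are collected in front so that each summand is a scalar times a monic polynomial of
    degree s, which exposes the leading coefficient. *)
Definition jacobi_poly (s a b : nat) : {poly R[i]} :=
  2^-1 ^+ s *: \sum_(m < s.+1)
     ('C(s + a, s - m) * 'C(s + b, m))%:R
     *: (('X - 1%:P) ^+ m * ('X - (-1)%:P) ^+ (s - m)).

Lemma jacobi_polyE s a b x : (jacobi_poly s a b).[x%:C] = (jacobi s a b x)%:C.
Proof.
rewrite /jacobi_poly hornerZ horner_sum mulr_sumr /jacobi rmorph_sum.
apply: eq_bigr => m _; rewrite hornerZ hornerM !horner_exp !hornerXsubC.
have half : (2^-1 : R[i]) = (2^-1)%:C by rewrite fmorphV rmorph_nat.
have ms : (m <= s)%N by rewrite -ltnS.
rewrite -[in 2^-1 ^+ s](subnKC ms) exprD half opprK.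
rewrite !rmorphM !rmorphXn !rmorphM rmorph_nat !rmorphD rmorphN rmorph1 !exprMn.
by ring.
Qed.

Let jacobi_factor s m : (m <= s)%N ->
  let P := ('X - 1%:P) ^+ m * ('X - (-1)%:P) ^+ (s - m) : {poly R[i]} in
  size P = s.+1 /\ P \is monic.
Proof.
move=> ms P; have mP : P \is monic.
  by rewrite rpredM ?rpredX ?monicXsubC.
split=> //; rewrite size_Mmonic ?monic_neq0 ?rpredX ?monicXsubC //.
by rewrite !size_exp_XsubC addSn /= addnS subnKC.
Qed.

Lemma size_jacobi_poly s a b : (size (jacobi_poly s a b) <= s.+1)%N.
Proof.
rewrite /jacobi_poly (leq_trans (size_scale_leq _ _))//.
apply: (leq_trans (size_sum _ _ _)); apply/bigmax_leqP => m _.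
rewrite (leq_trans (size_scale_leq _ _))//.
by have [|-> _] := @jacobi_factor s m; first rewrite -ltnS.
Qed.

(** Up to 2^-s the coefficient is a sum of natural numbers whose term at m = 0 is positive. Exact
    degree s is what permits elimination of leading terms. *)
Lemma jacobi_poly_lead s a b : (jacobi_poly s a b)`_s != 0.
Proof.
rewrite /jacobi_poly coefZ coef_sum mulf_neq0 ?expf_neq0 ?invr_eq0 ?pnatr_eq0//.
rewrite (eq_bigr (fun m : 'I_s.+1 => ('C(s + a, s - m) * 'C(s + b, m))%:R)).
  rewrite -natr_sum pnatr_eq0 big_ord_recl /= subn0 bin0 muln1 -lt0n.
  by rewrite addn_gt0 bin_gt0 leq_addr.
move=> m _; have [|sP mP] := @jacobi_factor s m; first by rewrite -ltnS.
by rewrite coefZ; move: mP; rewrite monicE lead_coefE sP /= => /eqP->; rewrite mulr1.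
Qed.

Lemma wignerD_weight l (k k' : int) : (maxn (absz k) (absz k') <= l)%N ->
  exists2 c : R[i], c != 0 & forall Q, SO3 Q -> wignerD l k k' Q =
    c * (weight k k' Q * (jacobi_poly (l - maxn (absz k) (absz k'))
           (absz (k - k')) (absz (k + k'))).[(Q o2 o2)%:C]).
Proof.
move=> kl; set s := (l - _)%N; set a := absz (k - k'); set b := absz (k + k').
pose c : R := Num.sqrt (2 * l + 1)%:R * ((-1) ^ (if k' < k then k + k' else 0) *
  Num.sqrt 'C(2 * l - s, s + a)%:R * (Num.sqrt 'C(s + b, b)%:R)^-1).
exists c%:C => [|Q SQ].
  have sqrt_nat n : (0 < n)%N -> Num.sqrt (n%:R : R) != 0.
    by move=> n0; rewrite sqrtr_eq0 -ltNge ltr0n.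
  rewrite fmorph_eq0 !mulf_neq0 ?invr_eq0 ?sqrt_nat ?addn1 ?bin_gt0 ?leq_addl//.
    by rewrite expfz_neq0// oppr_eq0 oner_neq0.
  (* The remaining binomial coefficient is positive because a <= 2 max(|k|,|k'|) = 2 (l - s). *)
  by rewrite /s /a; lia.
have := eulerAnglesP SQ; rewrite /wignerD /weight.
case: (eulerAngles Q) => [[al be] ga] [_ <-]; rewrite eulerE mxE /= jacobi_polyE.
by rewrite /wignerd -/s -/a -/b /c !rmorphM; ring.
Qed.

(** The weight accounts for degree max(|k|,|k'|) and the Jacobi factor for the remaining l -
    max(|k|,|k'|). *)
Lemma poly_le_bandlimited L f : bandlimited L f -> poly_le L f.
Proof.
move=> [c cf]; apply: poly_le_eq; last by move=> Q SQ; rewrite (cf Q SQ).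
apply: poly_le_sum => l; apply: poly_le_sum => i; apply: poly_le_sum => j /=.
set k := (_ - _); set k' := (_ - _).
have kl : (maxn (absz k) (absz k') <= l)%N.
  by rewrite /k /k'; have := ltn_ord i; have := ltn_ord j; lia.
apply: poly_le_scale; have [c' _ D] := wignerD_weight kl.
apply: (@poly_le_eq _ _ _ _ _ (fun Q SQ => esym (D Q SQ))).
apply: poly_le_scale; apply: (@poly_le_leq _ l); first by rewrite -ltnS.
rewrite -[X in poly_le X](subnKC kl).
apply: poly_le_mul; first exact: poly_le_weight.
by apply: poly_le_horner; exact: size_jacobi_poly.
Qed.

Lemma bandlimited_eq L f g :
  bandlimited L f -> (forall Q, SO3 Q -> f Q = g Q) -> bandlimited L g.
Proof. by move=> [c cf] fg; exists c => Q SQ; rewrite -fg// cf. Qed.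

Lemma bandlimited_add L f g :
  bandlimited L f -> bandlimited L g -> bandlimited L (fun Q => f Q + g Q).
Proof.
move=> [c cf] [d dg]; exists (fun l k k' => c l k k' + d l k k') => Q SQ.
rewrite cf// dg// -big_split; apply: eq_bigr => l _.
rewrite -big_split; apply: eq_bigr => i _; rewrite -big_split.
by apply: eq_bigr => j _ /=; rewrite mulrDl.
Qed.

Lemma bandlimited_scale L (a : R[i]) f :
  bandlimited L f -> bandlimited L (fun Q => a * f Q).
Proof.
move=> [c cf]; exists (fun l k k' => a * c l k k') => Q SQ.
rewrite cf// mulr_sumr; apply: eq_bigr => l _.
rewrite mulr_sumr; apply: eq_bigr => i _; rewrite mulr_sumr.
by apply: eq_bigr => j _ /=; rewrite mulrA.
Qed.

Lemma bandlimited_wignerD L l (k k' : int) :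
  (l <= L)%N -> (maxn (absz k) (absz k') <= l)%N -> bandlimited L (@wignerD R l k k').
Proof.
move=> lL kl.
exists (fun l0 k0 k0' => ([&& l0 == l, k0 == k & k0' == k'])%:R) => Q _.
have lL1 : (l < L.+1)%N by [].
have ki : (absz (k + l%:Z)%R < (2 * l).+1)%N by lia.
have kj : (absz (k' + l%:Z)%R < (2 * l).+1)%N by lia.
rewrite (bigD1 (Ordinal lL1))//= [X in _ = _ + X]big1 ?addr0; last first.
  move=> i; rewrite -val_eqE /= => /negPf il; apply: big1 => j _.
  by apply: big1 => j' _; rewrite il mul0r.
rewrite (bigD1 (Ordinal ki))//= [X in _ = _ + X]big1 ?addr0; last first.
  move=> i /negPf il; apply: big1 => j _ /=.
  have -> : (i%:Z - l%:Z == k) = false.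
    by apply/negbTE; move: il; apply: contraFN => /eqP ik; apply/eqP/val_inj => /=; lia.
  by rewrite andbF mul0r.
rewrite (bigD1 (Ordinal kj))//= [X in _ = _ + X]big1 ?addr0; last first.
  move=> i /negPf il /=.
  have -> : (i%:Z - l%:Z == k') = false.
    by apply/negbTE; move: il; apply: contraFN => /eqP ik; apply/eqP/val_inj => /=; lia.
  by rewrite !andbF mul0r.
have -> : Posz (absz (k + l%:Z)) - l%:Z = k by lia.
have -> : Posz (absz (k' + l%:Z)) - l%:Z = k' by lia.
by rewrite !eqxx mul1r.
Qed.

(** Triangular elimination by induction on the size of [P]: a multiple of the Jacobi polynomial of
    the same degree removes the leading term, and its product with the weight is a multiple of a
    Wigner function. *)
Lemma bandlimited_weight L (k k' : int) (P : {poly R[i]}) :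
  (maxn (absz k) (absz k') + size P <= L.+1)%N ->
  bandlimited L (fun Q => weight k k' Q * P.[(Q o2 o2)%:C]).
Proof.
set M := maxn _ _; move: (leqnn (size P)); move: {2 3}(size P) => n.
elim: n P => [|n IH] P Pn ML.
  move: Pn; rewrite leqn0 size_poly_eq0 => /eqP->.
  apply: bandlimited_eq (bandlimited_scale 0 (@bandlimited_wignerD L 0 0 0 _ _)) _ => //.
  by move=> Q _; rewrite horner0 mulr0 mul0r.
pose J := jacobi_poly n (absz (k - k')) (absz (k + k')).
pose c := P`_n / J`_n.
have JnN0 : J`_n != 0 by exact: jacobi_poly_lead.
(* At l = M + n the Jacobi factor has degree exactly n. *)
have [|c' c'0 D] := @wignerD_weight (M + n) k k'; first exact: leq_addr.
have bD : bandlimited L (@wignerD R (M + n) k k').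
  by apply: bandlimited_wignerD; [lia|exact: leq_addr].
have [||c1 c1E] := IH (P - c *: J); [|by lia|].
  apply/leq_sizeP => i; rewrite leq_eqVlt => /predU1P[<-|ni].
    by rewrite coefB coefZ /c divfK// subrr.
  rewrite coefB coefZ (leq_sizeP _ _ Pn)// (leq_sizeP _ _ (size_jacobi_poly _ _ _))//.
  by rewrite mulr0 subrr.
have bJ := bandlimited_scale (c / c') bD.
have bPJ := ex_intro _ c1 c1E : bandlimited L (fun Q => _).
apply: bandlimited_eq (bandlimited_add bPJ bJ) _ => Q SQ.
rewrite D// addKn -/J -/M mulrA divfK// hornerD hornerN hornerZ.
by ring.
Qed.

End WignerPolynomials.

(** * Products of band-limited functions, and band-limitation of polynomials *)

Section Bandlimited.
Variable R : realType.
Implicit Types (Q : 'M[R]_3) (f g : 'M[R]_3 -> R[i]) (L l m n s : nat) (k : int).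

Lemma bandlimited_sum L (J : finType) (F : J -> 'M[R]_3 -> R[i]) :
  (forall j, bandlimited L (F j)) -> bandlimited L (fun Q => \sum_j F j Q).
Proof.
move=> bF; elim: (index_enum J) => [|j r IH].
  exists (fun _ _ _ => 0) => Q _; rewrite big_nil big1// => l _.
  by rewrite big1// => i _; rewrite big1// => i' _ /=; rewrite mul0r.
by apply: bandlimited_eq (bandlimited_add (bF j) IH) _ => Q _; rewrite big_cons.
Qed.

Lemma maxn_absz (x y : int) :
  ((maxn (absz x) (absz y)).*2 = absz (x - y)%R + absz (x + y)%R)%N.
Proof. by lia. Qed.

(** The product is the weight at (k + p, k' + p') times a polynomial of degree at most s + s' + i +
    j, and the maximum of the summed indices falls short of the sum of the two maxima by exactly i +
    j. *)
Lemma bandlimited_weightM m n s s' (k k' p p' : int) (P P' : {poly R[i]}) :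
  (maxn (absz k) (absz k') + s <= m)%N -> (size P <= s.+1)%N ->
  (maxn (absz p) (absz p') + s' <= n)%N -> (size P' <= s'.+1)%N ->
  bandlimited (m + n) (fun Q => (weight k k' Q * P.[(Q o2 o2)%:C])
                              * (weight p p' Q * P'.[(Q o2 o2)%:C])).
Proof.
move=> km Ps pn Ps'.
have [i Ei] := absz_add_defect (k - k') (p - p').
rewrite [_ - _ + _](_ : _ = k + p - (k' + p')) in Ei; last by ring.
have [j Ej] := absz_add_defect (k + k') (p + p').
rewrite [_ + _ + _](_ : _ = k + p + (k' + p')) in Ej; last by ring.
pose U : {poly R[i]} := 2^-1 *: (1%:P - 'X); pose V : {poly R[i]} := 2^-1 *: (1%:P + 'X).
have sU : (size U <= 2)%N.
  rewrite (leq_trans (size_scale_leq _ _))// (leq_trans (size_polyD _ _))//.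
  by rewrite size_polyN size_polyX size_polyC oner_neq0.
have sV : (size V <= 2)%N.
  rewrite (leq_trans (size_scale_leq _ _))// (leq_trans (size_polyD _ _))//.
  by rewrite size_polyX size_polyC oner_neq0.
have sexp (W : {poly R[i]}) e : (size W <= 2)%N -> (size (W ^+ e) <= e.+1)%N.
  move=> sW; rewrite (leq_trans (size_poly_exp_leq _ _))// ltnS.
  by rewrite -[leqRHS]mul1n leq_mul2r -subn1 leq_subLR sW orbT.
have := @bandlimited_weight R (m + n) (k + p) (k' + p') (P * P' * U ^+ i * V ^+ j).
move=> /(_ _) /bandlimited_eq; apply.
  have := maxn_absz (k + p) (k' + p'); have := maxn_absz k k'; have := maxn_absz p p'.
  move: Ei Ej km pn Ps Ps' (sexp _ i sU) (sexp _ j sV) (size_polyMleq P P')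
    (size_polyMleq (P * P') (U ^+ i)) (size_polyMleq (P * P' * U ^+ i) (V ^+ j)).
  move: (size (P * P' * U ^+ i * V ^+ j)) (size (P * P' * U ^+ i)) (size (P * P'))
    (size (U ^+ i)) (size (V ^+ j)) (size P) (size P') (maxn _ _) (maxn _ _) (maxn _ _)
    (absz _) (absz _) (absz _) (absz _) (absz _) (absz _) => *; lia.
move=> Q SQ; rewrite mulrACA (weightM Ei Ej SQ) !hornerM !horner_exp !hornerZ.
by rewrite hornerD hornerN hornerD !hornerC hornerX; ring.
Qed.

(** By bilinearity it suffices to multiply two Wigner functions, each a weight times a Jacobi
    polynomial. *)
Lemma bandlimited_mul m n f g :
  bandlimited m f -> bandlimited n g -> bandlimited (m + n) (fun Q => f Q * g Q).
Proof.
have bounds l (i j : 'I_(2 * l).+1) :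
    (maxn (absz (i%:Z - l%:Z)) (absz (j%:Z - l%:Z)) <= l)%N.
  by have := ltn_ord i; have := ltn_ord j; lia.
move=> [c cf] [d dg].
apply: (@bandlimited_eq _ _ (fun Q =>
  \sum_(l < m.+1) \sum_(i < (2 * l).+1) \sum_(j < (2 * l).+1)
  \sum_(l' < n.+1) \sum_(i' < (2 * l').+1) \sum_(j' < (2 * l').+1)
    (c l (i%:Z - l%:Z) (j%:Z - l%:Z) * d l' (i'%:Z - l'%:Z) (j'%:Z - l'%:Z))
     * (wignerD l (i%:Z - l%:Z) (j%:Z - l%:Z) Q
        * wignerD l' (i'%:Z - l'%:Z) (j'%:Z - l'%:Z) Q))); last first.
  move=> Q SQ; rewrite cf// dg// mulr_suml; apply: eq_bigr => l _.
  rewrite mulr_suml; apply: eq_bigr => i _; rewrite mulr_suml; apply: eq_bigr => j _.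
  rewrite mulr_sumr; apply: eq_bigr => l' _.
  rewrite mulr_sumr; apply: eq_bigr => i' _; rewrite mulr_sumr; apply: eq_bigr => j' _.
  by rewrite mulrACA.
apply: bandlimited_sum => l; apply: bandlimited_sum => i; apply: bandlimited_sum => j.
apply: bandlimited_sum => l'; apply: bandlimited_sum => i'; apply: bandlimited_sum => j'.
apply: bandlimited_scale.
have kl := bounds _ i j; have kl' := bounds _ i' j'.
have [a _ aE] := wignerD_weight R kl; have [b _ bE] := wignerD_weight R kl'.
have lm : (maxn (absz (i%:Z - l%:Z)) (absz (j%:Z - l%:Z)) +
    (l - maxn (absz (i%:Z - l%:Z)) (absz (j%:Z - l%:Z))) <= m)%N.
  by rewrite subnKC// -ltnS.
have lm' : (maxn (absz (i'%:Z - l'%:Z)) (absz (j'%:Z - l'%:Z)) +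
    (l' - maxn (absz (i'%:Z - l'%:Z)) (absz (j'%:Z - l'%:Z))) <= n)%N.
  by rewrite subnKC// -ltnS.
have bb := bandlimited_weightM lm (size_jacobi_poly R _ _ _)
  lm' (size_jacobi_poly R _ _ _).
apply: bandlimited_eq (bandlimited_scale (a * b) (bb _ _ _ _)) _ => Q SQ.
by rewrite aE// bE// mulrACA.
Qed.

Lemma bandlimited_poly_le n f : poly_le n f -> bandlimited n f.
Proof.
have bw (k k' : int) : (maxn (absz k) (absz k') <= 1)%N ->
    bandlimited 1 (@weight R k k').
  move=> k1; apply: (@bandlimited_eq _ _ _ _ (@bandlimited_weight R 1 k k' 1 _)).
    by rewrite size_poly1; lia.
  by move=> Q _; rewrite hornerE mulr1.
have bsc c (k k' : int) : (maxn (absz k) (absz k') <= 1)%N ->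
    bandlimited 1 (fun Q => c * @weight R k k' Q).
  by move=> /bw; exact: bandlimited_scale.
pose I : R[i] := Complex 0 1.
have II : I ^+ 2 = - 1.
  by rewrite expr2; apply/eqP; rewrite eq_complex /=; apply/andP;
    split; apply/eqP; ring.
have half : (2^-1)%:C = (2^-1 : R[i]) by rewrite fmorphV rmorph_nat.
elim=> {n f} [n c|||m n f g _ mf _ ng|n f g _ nf fg].
- apply: (@bandlimited_eq _ _ _ _ (@bandlimited_weight R n 0 0 c%:P _)).
    by rewrite max0n add0n (leq_trans (size_polyC_leq1 _)).
  by move=> Q /weight_generators[-> _ _ _ _]; rewrite hornerC mul1r.
(* The linear relations for the generators are inverted: [diag] serves the upper left 2x2 block,
   [vert] the last column and [horiz] the last row. The corner entry is cos beta, the trivial weight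
   times 'X. *)
- have diag (a b c d : R[i]) : bandlimited 1 (fun Q => a * weight 1 1 Q
      + b * weight (-1) (-1) Q + c * weight 1 (-1) Q + d * weight (-1) 1 Q).
    by do 3?[apply: bandlimited_add]; exact: bsc.
  have vert (a b : R[i]) :
      bandlimited 1 (fun Q => a * weight 1 0 Q + b * weight (-1) 0 Q).
    by apply: bandlimited_add; exact: bsc.
  have horiz (a b : R[i]) :
      bandlimited 1 (fun Q => a * weight 0 1 Q + b * weight 0 (-1) Q).
    by apply: bandlimited_add; exact: bsc.
  do 2!apply: forall_ord3.
  + apply: bandlimited_eq (diag 2^-1 2^-1 (- 2^-1) (- 2^-1)) _ => Q /weight_generators
      [_ _ _ [-> ->] [-> ->]]; by rewrite half -/I; field: II.
  + apply: bandlimited_eq (diag (- I / 2) (I / 2) (- I / 2) (I / 2)) _ => Q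
      /weight_generators [_ _ _ [-> ->] [-> ->]]; by rewrite half -/I; field: II.
  + apply: bandlimited_eq (vert 1 1) _ => Q /weight_generators [_ [-> ->] _ _ _].
    by rewrite half -/I; field: II.
  + apply: bandlimited_eq (diag (I / 2) (- I / 2) (- I / 2) (I / 2)) _ => Q
      /weight_generators [_ _ _ [-> ->] [-> ->]]; by rewrite half -/I; field: II.
  + apply: bandlimited_eq (diag 2^-1 2^-1 2^-1 2^-1) _ => Q /weight_generators
      [_ _ _ [-> ->] [-> ->]]; by rewrite half -/I; field: II.
  + apply: bandlimited_eq (vert I (- I)) _ => Q /weight_generators [_ [-> ->] _ _ _].
    by rewrite half -/I; field: II.
  + apply: bandlimited_eq (horiz (- 1) (- 1)) _ => Q /weight_generators [_ _ [-> ->] _ _].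
    by rewrite half -/I; field: II.
  + apply: bandlimited_eq (horiz I (- I)) _ => Q /weight_generators [_ _ [-> ->] _ _].
    by rewrite half -/I; field: II.
  + apply: (@bandlimited_eq _ _ _ _ (@bandlimited_weight R 1 0 0 'X _)).
      by rewrite size_polyX.
    by move=> Q /weight_generators[-> _ _ _ _]; rewrite hornerX mul1r.
- by move=> n f g _ nf _ ng; exact: bandlimited_add.
- exact: bandlimited_mul.
- exact: bandlimited_eq nf fg.
Qed.

End Bandlimited.

(** * Orthonormal frames, existence of the gradient and its components *)

Section Frames.
Variable R : realType.
Implicit Types (S T U Q : 'M[R]_3) (f : 'M[R]_3 -> R[i]).

Definition orthonormal_frame (E : 'I_3 -> 'M[R]_3 -> 'M[R]_3) := forall Q, SO3 Q ->
  [/\ forall j, tangentSO3 Q (E j Q),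
      forall j k, metricSO3 (E j Q) (E k Q) = (j == k)%:R &
      forall T, tangentSO3 Q T -> T = \sum_(j < 3) metricSO3 T (E j Q) *: E j Q].

Lemma metricSO3_tr T U : metricSO3 T U = 2^-1 * \tr (T^T *m U).
Proof.
rewrite /metricSO3 exchange_big; congr (_ * _); apply: eq_bigr => j _.
by rewrite mxE; apply: eq_bigr => i _; rewrite mxE.
Qed.

Lemma metricSO3_suml (a : 'I_3 -> R) (F : 'I_3 -> 'M[R]_3) U :
  metricSO3 (\sum_j a j *: F j) U = \sum_j a j * metricSO3 (F j) U.
Proof.
rewrite metricSO3_tr linear_sum /= mulmx_suml raddf_sum mulr_sumr; apply: eq_bigr => j _.
by rewrite metricSO3_tr linearZ /= -scalemxAl mxtraceZ mulrCA.
Qed.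

Lemma metricSO3C T U : metricSO3 T U = metricSO3 U T.
Proof.
by congr (_ * _); apply: eq_bigr => i _; apply: eq_bigr => j _; rewrite mulrC.
Qed.

Lemma metricSO3_right Q S T : SO3 Q -> metricSO3 (S *m Q) (T *m Q) = metricSO3 S T.
Proof.
move=> [/mulmx1C QQ _]; rewrite !metricSO3_tr trmx_mul -mulmxA mxtrace_mulC.
by rewrite -!mulmxA QQ mulmx1.
Qed.

Lemma metricSO3_left Q S T : SO3 Q -> metricSO3 (Q *m S) (Q *m T) = metricSO3 S T.
Proof.
move=> [QQ _]; rewrite !metricSO3_tr trmx_mul -mulmxA.
by rewrite [Q^T *m _]mulmxA QQ mul1mx.
Qed.

Lemma e_so3 j : so3 (@e_ R j).
Proof. by move: j; apply: forall_ord3; apply: eq_mx3; rewrite !mxE /= ?opprK ?oppr0. Qed.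

(** The factor 1/2 in the metric offsets the two unit entries of each basis matrix. *)
Lemma metricSO3_e (j k : 'I_3) : metricSO3 (@e_ R j) (e_ R k) = (j == k)%:R.
Proof.
by move: j k; do 2?apply: forall_ord3; rewrite /metricSO3 !(sum_ord3, mxE) /=; field.
Qed.

Lemma so3_expand S : so3 S -> S = \sum_j metricSO3 S (e_ R j) *: e_ R j.
Proof.
move=> /so3_skew; move: (S o2 o1) (S o0 o2) (S o1 o0) => x y z ->.
rewrite !(sum_ord3) /metricSO3 !sum_ord3.
by apply: eq_mx3; rewrite !mxE /=; field.
Qed.

Lemma so3_conj Q S : so3 S -> so3 (Q *m S *m Q^T).
Proof.
by rewrite /so3 /= => skS; rewrite !trmx_mul trmxK skS mulNmx mulmxN mulmxA.
Qed.

Lemma rightFrame_orthonormal : orthonormal_frame (@rightFrame R).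
Proof.
move=> Q SQ; split=> [j|j k|T [S sS ->]].
- by exists (e_ R j); first exact: e_so3.
- by rewrite metricSO3_right// metricSO3_e.
- rewrite {1}(so3_expand sS) mulmx_suml; apply: eq_bigr => j _.
  by rewrite -scalemxAl metricSO3_right.
Qed.

(** Conjugation passes between the two descriptions of the tangent space: Q e_j = (Q e_j Q^T) Q, and
    S Q = Q (Q^T S Q) is expanded through the skew matrix Q^T S Q. *)
Lemma leftFrame_orthonormal : orthonormal_frame (@leftFrame R).
Proof.
move=> Q SQ; have [QtQ _] := SQ; have QQt := mulmx1C QtQ.
split=> [j|j k|T [S sS ->]].
- exists (Q *m e_ R j *m Q^T); first by apply: so3_conj; exact: e_so3.
  by rewrite -[RHS]mulmxA QtQ mulmx1.
- by rewrite metricSO3_left// metricSO3_e.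
- have SQE : S *m Q = Q *m (Q^T *m S *m Q) by rewrite !mulmxA QQt mul1mx.
  have /so3_expand := so3_conj Q^T sS; rewrite trmxK => expand.
  rewrite SQE {1}expand mulmx_sumr; apply: eq_bigr => j _.
  by rewrite -scalemxAr metricSO3_left.
Qed.

Lemma is_gradient_components f G E : orthonormal_frame E -> is_gradient f G ->
  exists c, is_components E G c.
Proof.
move=> frE [GRe [GIm [gRe gIm GE]]].
exists (fun j Q => metricSO3 (GRe Q) (E j Q) +i* metricSO3 (GIm Q) (E j Q)) => Q SQ.
have [_ _ expand] := frE Q SQ.
rewrite (GE Q SQ) {1}(expand _ (gRe Q SQ).1) {1}(expand _ (gIm Q SQ).1).
apply/matrixP => a b; rewrite !sum_ord3 !mxE -complexiE.
by apply/eqP; rewrite eq_complex /=; apply/andP; split; apply/eqP; ring.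
Qed.

(** By orthonormality a component is the inner product of the gradient with a frame vector, which by
    definition of the gradient is the derivative along that vector. *)
Lemma is_components_unique f d G E c :
  (forall Q S, SO3 Q -> so3 S -> has_dir_derive f Q S (d Q (S *m Q))) ->
  orthonormal_frame E -> is_gradient f G -> is_components E G c ->
  forall j Q, SO3 Q -> c j Q = d Q (E j Q).
Proof.
move=> dder frE [GRe [GIm [gRe gIm GE]]] Gc j Q SQ.
have [tanE orthE _] := frE Q SQ; have [S sS SE] := tanE j.
have [dRe dIm] := dder Q S SQ sS.
have := Gc Q SQ; rewrite GE// => Gsum.
(* The frame is real, so the expansion splits into real and imaginary parts of the coefficients. *)
have GReE : GRe Q = \sum_k complex.Re (c k Q) *: E k Q.
  apply/matrixP => a b; move: (congr1 (fun A : 'M[R[i]]_3 => complex.Re (A a b)) Gsum).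
  rewrite !sum_ord3 !mxE -complexiE !ReD !ReM /=; lra.
have GImE : GIm Q = \sum_k complex.Im (c k Q) *: E k Q.
  apply/matrixP => a b; move: (congr1 (fun A : 'M[R[i]]_3 => complex.Im (A a b)) Gsum).
  rewrite !sum_ord3 !mxE -complexiE !ImD !ImM /=; lra.
have coef (a : 'I_3 -> R) : metricSO3 (\sum_k a k *: E k Q) (E j Q) = a j.
  rewrite metricSO3_suml (bigD1 j)//= orthE eqxx mulr1 big1 ?addr0// => k /negPf kj.
  by rewrite orthE kj mulr0.
have ReE : complex.Re (c j Q) = complex.Re (d Q (E j Q)).
  rewrite -[LHS](coef (fun k => complex.Re (c k Q))) -GReE SE.
  rewrite -(@derive_val _ _ _ _ _ _ _ dRe).
  by rewrite (@derive_val _ _ _ _ _ _ _ ((gRe Q SQ).2 S sS)).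
have ImE : complex.Im (c j Q) = complex.Im (d Q (E j Q)).
  rewrite -[LHS](coef (fun k => complex.Im (c k Q))) -GImE SE.
  rewrite -(@derive_val _ _ _ _ _ _ _ dIm).
  by rewrite (@derive_val _ _ _ _ _ _ _ ((gIm Q SQ).2 S sS)).
by apply/eqP; rewrite eq_complex ReE ImE !eqxx.
Qed.

(** The candidate has the derivatives along the right-invariant frame as coefficients; linearity of
    [d] extends the defining identity to all tangent vectors. *)
Lemma gradient_exists f d :
  (forall Q a T U, d Q (a *: T + U) = a%:C * d Q T + d Q U) ->
  (forall Q S, SO3 Q -> so3 S -> has_dir_derive f Q S (d Q (S *m Q))) ->
  exists G, is_gradient f G.
Proof.
move=> dlin dder.
(* [phi] stands for the real or the imaginary part, both real-linear. *)
have real_grad (phi : R[i] -> R) : (forall x y, phi (x + y) = phi x + phi y) ->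
    (forall (a : R) x, phi (a%:C * x) = a * phi x) ->
    (forall Q S, SO3 Q -> so3 S -> is_derive (0 : R) (1 : R)
       (fun t => phi (f (expmx (t *: S) *m Q))) (phi (d Q (S *m Q)))) ->
    is_real_gradient (fun Q => phi (f Q))
      (fun Q => \sum_j phi (d Q (rightFrame j Q)) *: rightFrame j Q).
  move=> phiD phiZ der Q SQ; have [_ _ expand] := rightFrame_orthonormal SQ.
  have d0 : d Q 0 = 0.
    have := dlin Q 1 0 0; rewrite scaler0 addr0 mul1r => /eqP.
    by rewrite -subr_eq0 opprD addNKr oppr_eq0 => /eqP.
  split=> [|S sS].
    exists (\sum_j phi (d Q (rightFrame j Q)) *: e_ R j).
      rewrite /so3 /= linear_sum /= -sumrN; apply: eq_bigr => j _.
      by rewrite linearZ /= (e_so3 j) scalerN.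
    by rewrite mulmx_suml; apply: eq_bigr => j _; rewrite scalemxAl.
  apply: is_derive_eq; first exact: der.
  have TQ : tangentSO3 Q (S *m Q) by exists S.
  rewrite metricSO3_suml {1}(expand _ TQ) !sum_ord3 -!addrA.
  rewrite !dlin -[_ *: rightFrame o2 Q]addr0 dlin d0 addr0 !phiD !phiZ.
  by rewrite ![metricSO3 (S *m Q) _]metricSO3C !addrA; congr (_ + _ + _); rewrite mulrC.
pose GRe Q := \sum_j complex.Re (d Q (rightFrame j Q)) *: rightFrame j Q.
pose GIm Q := \sum_j complex.Im (d Q (rightFrame j Q)) *: rightFrame j Q.
exists (fun Q => mxC (GRe Q) + 'i *: mxC (GIm Q)), GRe, GIm; split=> //.
- apply: real_grad => [||Q S SQ sS]; first exact: ReD.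
    by move=> a x; rewrite ReM /= mul0r subr0.
  by have [] := dder Q S SQ sS.
- apply: real_grad => [||Q S SQ sS]; first exact: ImD.
    by move=> a x; rewrite ImM /= mul0r addr0.
  by have [] := dder Q S SQ sS.
Qed.

End Frames.

Theorem corollary4p5 (R : realType) (L : nat) (f : 'M[R]_3 -> R[i])
    (hf : bandlimited L f) :
  (exists (G : 'M[R]_3 -> 'M[R[i]]_3) (cL cR : 'I_3 -> 'M[R]_3 -> R[i]),
     [/\ is_gradient f G,
         is_components (@leftFrame R) G cL &
         is_components (@rightFrame R) G cR]) /\
  (forall (G : 'M[R]_3 -> 'M[R[i]]_3) (cL cR : 'I_3 -> 'M[R]_3 -> R[i]),
     is_gradient f G ->
     is_components (@leftFrame R) G cL ->
     is_components (@rightFrame R) G cR ->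
     (forall j : 'I_3, bandlimited L (cL j)) /\
     (forall j : 'I_3, bandlimited L (cR j))).
Proof.
have [d [dlin dder dpol]] := poly_le_derive (poly_le_bandlimited hf).
split.
  have [G fG] := gradient_exists dlin dder.
  have [cL GL] := is_gradient_components (@leftFrame_orthonormal R) fG.
  have [cR GR] := is_gradient_components (@rightFrame_orthonormal R) fG.
  by exists G, cL, cR.
(* Among the fields A Q B, the choice A = 1, B = e_j is the left frame and A = e_j, B = 1 the right
   one; the components are thus polynomials of degree at most L. *)
move=> G cL cR fG GL GR; split=> j; apply: bandlimited_poly_le.
- apply: poly_le_eq (dpol 1%:M (e_ R j)) _ => Q SQ; rewrite mul1mx.
  by rewrite (is_components_unique dder (@leftFrame_orthonormal R) fG GL).
- apply: poly_le_eq (dpol (e_ R j) 1%:M) _ => Q SQ; rewrite mulmx1.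
  by rewrite (is_components_unique dder (@rightFrame_orthonormal R) fG GR).
Qed.
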